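(* Let $X$ be a complete metric space and let $w_1,\ldots,w_N$ be contracting homeomorphisms of $X$ onto $X$. The system $(w_1,\ldots,w_N)$ satisfies the strong Markov property (SMP) if and only if $(w_1,\ldots,w_N)\in\bigcap_{n=1}^{\infty}\mathcal V_n$.
   Context: $\mathbb N=\{1,2,\ldots\}$, $N\in\mathbb N$, and $d$ is the distance in $X$. A mapping $w:X\to X$ is contracting if $\sigma(w)=\sup_{x\neq y\in X}\frac{d(w(x),w(y))}{d(x,y)}<1$. $\mathcal M(X)$ denotes the set of all contracting homeomorphisms of $X$ onto itself. For $(w_1,\ldots,w_N)\in(\mathcal M(X))^N$, the attractor $A=A(w_1,\ldots,w_N)$ is the unique non-empty compact subset of $X$ with $A=\bigcup_{i=1}^N w_i(A)$. Let $\Sigma=\{1,\ldots,N\}$, and for $\mathbf i=(i_1,\ldots,i_n)\in\Sigma^n$ let $w_{\mathbf i}=w_{i_1}\circ\cdots\circ w_{i_n}$. For $n\in\mathbb N$, $\mathcal V_n$ is the set of all ordered $N$-tuples $(w_1,\ldots,w_N)\in(\mathcal M(X))^N$ such that for every $\mathbf i\in\Sigma^n$, $w_{\mathbf i}(A)\nsubseteq\bigcup_{\mathbf j\in\Sigma^n,\ \mathbf j\neq\mathbf i}w_{\mathbf j}(A)$. A system $(w_1,\ldots,w_N)\in(\mathcal M(X))^N$ satisfies the strong Markov property (SMP) if for every $n\in\mathbb N$ there is an open set $\mathcal O_n\subset X$ such that (1) $\overline{\mathcal O_n\cap A}=A$; and (2) $w_{\mathbf i}(\mathcal O_n)\cap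 w_{\mathbf j}(\mathcal O_n)=\emptyset$ for all $\mathbf i\neq\mathbf j\in\Sigma^n$. *)

(* Defs.v *)
From HB Require Import structures.
From mathcomp Require Import all_boot all_order all_algebra.
From mathcomp Require Import all_classical all_reals all_analysis.

Set Implicit Arguments.
Unset Strict Implicit.
Unset Printing Implicit Defensive.

Import Order.TTheory GRing.Theory Num.Theory.

Local Open Scope classical_set_scope.
Local Open Scope ring_scope.

(* [Complete] is based on pointed types, so these spaces are non-empty; this is
   needed for a non-empty attractor to exist. *)
#[short(type="completeMetricType")]
HB.structure Definition CompleteMetric (R : numDomainType) :=
  {T of Complete T & Metric R T}.

Section ContractingHomeomorphisms.
Context {R : realType} {X : metricType R}.

(* The supremum is taken in the extended reals: it is [+oo] when the ratios are
   unbounded (the real-valued [sup] would be 0), and [-oo] when X is a single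
   point, in which case every map is contracting. *)
Definition contraction_ratio (f : X -> X) : \bar R :=
  ereal_sup [set ((mdist (f p.1) (f p.2) / mdist p.1 p.2)%:E)
            | p in [set p : X * X | p.1 <> p.2]].

Definition contracting (f : X -> X) : Prop := (contraction_ratio f < 1)%E.

Definition homeomorphism (f : X -> X) : Prop :=
  exists g : X -> X,
    [/\ cancel f g, cancel g f, continuous f & continuous g].

Definition contracting_homeo : set (X -> X) :=
  [set f | contracting f /\ homeomorphism f].

End ContractingHomeomorphisms.

Section Systems.
Context {R : realType} {X : metricType R} {N : nat}.
Implicit Types (w : 'I_N -> X -> X) (n : nat).

Definition is_attractor w (A : set X) : Prop :=
  [/\ A !=set0, compact A & A = \bigcup_(i : 'I_N) (w i @` A)].

(* When X is complete, N > 0 and the w i are contracting, there is exactly one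
   set satisfying [is_attractor w], so the default value [set0] is not used. *)
Definition attractor w : set X := xget set0 (is_attractor w).

(* w_{i_1} \o ... \o w_{i_n} for i = [:: i_1; ...; i_n] *)
Definition word_map w (i : seq 'I_N) : X -> X :=
  foldr (fun k f => w k \o f) id i.

Definition V_ n : set ('I_N -> X -> X) :=
  [set w | (forall k, contracting_homeo (w k)) /\
    forall i : n.-tuple 'I_N,
      ~ (word_map w i @` attractor w `<=`
         \bigcup_(j in [set j : n.-tuple 'I_N | j <> i])
            (word_map w j @` attractor w))].

Definition strong_Markov w : Prop :=
  forall n, (0 < n)%N -> exists O : set X,
    [/\ open O,
        closure (O `&` attractor w) = attractor w &
        forall i j : n.-tuple 'I_N, i <> j ->
          (word_map w i @` O) `&` (word_map w j @` O) = set0].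

End Systems.

(* Main.v *)
Require Import Defs.
From mathcomp Require Import all_boot all_order all_algebra.
From mathcomp Require Import all_classical all_reals all_analysis.
From mathcomp Require Import ring lra.

Local Open Scope classical_set_scope.

(** Write A for the attractor and call the sets w_i(A), for words i of length n,
the pieces of level n.  The class V_n says that every piece of level n has a
point outside the union of the other ones ([other_pieces]).

From the strong Markov property to V_n: if w_i(A) were covered by the other
pieces, take y in A and in O_n.  Then w_i(y) = w_j(z) with z in A and j <> i.
Since w_i is a homeomorphism, w_i(O_n) is an open neighbourhood of w_j(z), and
z is a limit of points t of A in O_n; for such a t close to z, w_j(t) lies in
both w_i(O_n) and w_j(O_n), which are disjoint.

From all the V_n to the strong Markov property: fix n.  For a word i of length
n, consider the points x of A such that w_i(x) lies on no other piece of level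
n.  They form a relatively open subset of A, as pieces are compact, and this
subset is dense ([dense_not_other_pieces]): near any point of A there is a tiny
piece w_u(A) with u long, and V applied at level n + |u| to the concatenation
iu gives a point of w_i(w_u(A)) off all other pieces of level n.  There are
finitely many words i, so the points x that are good for all i at once are
still dense in A.  To thicken this set into an open subset of X, let O_n be the
set of points x such that, for all i <> j, w_i(x) is strictly closer to w_i(A)
than to w_j(A) ([closer]).  A common point of w_i(O_n) and w_j(O_n) would be
strictly closer to each of the two pieces than to the other.

Both directions use that A is a genuine attractor, and the first one that it is
not empty, so its existence is proved as well ([attractorP]).  Let E be the orbit,
under all words, of the fixed point of one of the maps.  It is bounded, and it
is the union of its images under the maps; since the maps are homeomorphisms,
the same holds for its closure.  Finally, a closed bounded set that is
the union of its images is compact by completeness, because for each length m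
it is a finite union of pieces of level m, whose diameters tend to 0. *)

(** * Metric spaces: diameters, contractions, comparison of distances *)

Section MetricFacts.
Set Implicit Arguments.
Unset Strict Implicit.
Local Open Scope ring_scope.
Import Order.TTheory GRing.Theory Num.Theory.
Context {R : realType} {X : metricType R}.
Implicit Types (A B : set X) (f : X -> X) (x y z : X).

Definition has_finite_diameter A : Prop :=
  exists D : R, forall x y, A x -> A y -> mdist x y <= D.

Lemma finite_diameter_of_radius A x (D : R) :
  (forall y, A y -> mdist x y <= D) -> has_finite_diameter A.
Proof.
move=> AD; exists (D + D) => y z /AD xy /AD xz.
by rewrite (le_trans (metric_triangle y x z))// (metric_sym y) lerD.
Qed.

Lemma compact_finite_diameter A : compact A -> has_finite_diameter A.
Proof.
move=> /compact_near_coveringP cA.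
have [->|/set0P[x0 _]] := eqVneq A set0; first by exists 0.
have [|D [_ AD]] := cA R +oo (fun D y => mdist x0 y <= D) _.
  move=> y _; exists (ball y 1, [set D | mdist x0 y + 1 < D]).
    split; first exact: nbhsx_ballx.
    by exists (mdist x0 y + 1); split => //; rewrite num_real.
  move=> [z D] [/= + yD]; rewrite ballEmdist/= => yz.
  apply: ltW; apply: le_lt_trans yD.
  by rewrite (le_trans (metric_triangle _ y _))// lerD2l ltW.
apply: (@finite_diameter_of_radius _ x0 (D + 1)) => y Ay.
by apply: AD => //; rewrite ltrDl.
Qed.

Lemma closure_finite_diameter A :
  has_finite_diameter A -> has_finite_diameter (closure A).
Proof.
move=> [D AD]; exists (1 + D + 1) => x y Ax Ay.
have [x' [Ax' +]] := Ax _ (nbhsx_ballx x 1 ltr01).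
have [y' [Ay' +]] := Ay _ (nbhsx_ballx y 1 ltr01).
rewrite !ballEmdist/= => yy' xx'; have x'y' := AD _ _ Ax' Ay'.
have := metric_triangle x x' y; have := metric_triangle x' y' y.
by rewrite (metric_sym y' y); lra.
Qed.

(** The ratio is an extended real and equals -oo on a one-point space, whence
the maximum with 0 in the choice of c. *)
Lemma contracting_lipschitz f : contracting f ->
  exists c : R,
    [/\ 0 <= c, c < 1 & forall x y, mdist (f x) (f y) <= c * mdist x y].
Proof.
rewrite /contracting => f1.
have [c [c0 c1 fc]] : exists c : R,
    [/\ 0 <= c, c < 1 & (contraction_ratio f <= c%:E)%E].
  case: (contraction_ratio f) f1 => [r||]//; last by exists 0; rewrite leNye.
  rewrite lte_fin => r1; exists (Num.max r 0).
  by rewrite le_max lexx orbT gt_max r1 ltr01 lee_fin le_max lexx.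
exists c; split => // x y; have [->|/eqP xy] := eqVneq x y.
  by rewrite !mdistxx mulr0.
rewrite -ler_pdivrMr ?mdist_gt0; last exact/eqP.
by rewrite -lee_fin (le_trans _ fc)//; apply: ereal_sup_ubound; exists (x, y).
Qed.

(** The points z with d(z, A) < d(z, B), the infima being replaced by a witness
a in A and a lower bound r on the distances to B; this avoids the infimum over
an empty set. *)
Definition closer A B : set X := [set z | exists (a : X) (r : R),
  [/\ A a, mdist z a < r & forall b, B b -> r <= mdist z b]].

Lemma open_closer A B : open (closer A B).
Proof.
rewrite openE => z [a [r [Aa zr Br]]].
have e0 : 0 < (r - mdist z a) / 2 by lra.
apply: filterS (nbhsx_ballx z _ e0) => z'; rewrite ballEmdist/= => zz'.
exists a, (r - (r - mdist z a) / 2); split => //.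
  by have := metric_triangle z' z a; rewrite (metric_sym z' z); lra.
by move=> b /Br; have := metric_triangle z z' b; lra.
Qed.

Lemma closer_asym A B z : closer A B z -> ~ closer B A z.
Proof.
move=> [a [r [Aa za Br]]] [b [s [Bb zb As]]].
by have := Br _ Bb; have := As _ Aa; lra.
Qed.

(** A point of A off the closed set B has distance 0 to A and a positive
distance to B. *)
Lemma closer_setD A B a : closed B -> A a -> ~ B a -> closer A B a.
Proof.
move=> cB Aa nBa.
have /nbhs_ballP[r /= r0 rB] : nbhs a (~` B).
  by apply: open_nbhs_nbhs; split => //; exact: closed_openC.
exists a, r; rewrite mdistxx; split => // b Bb.
rewrite leNgt; apply/negP => ab; apply: (rB b) => //.
by rewrite ballEmdist.
Qed.

End MetricFacts.

(** * Finite intersections of open sets, and ultrafilters *)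

Section TopologicalFacts.
Set Implicit Arguments.
Unset Strict Implicit.
Local Open Scope ring_scope.

(** Add the sets one at a time: a neighbourhood of a point of A contains a point
of A in the open set V i, and around that point the induction hypothesis is used
inside V i. *)
Lemma dense_open_bigcap {T : topologicalType} {I : finType} (A : set T)
    (V : I -> set T) :
    (forall i, open (V i)) -> (forall i, A `<=` closure (A `&` V i)) ->
  A `<=` closure (A `&` \bigcap_i V i).
Proof.
move=> oV dV.
have fin (s : seq I) : A `<=` closure (A `&` \bigcap_(i in [set` s]) V i).
  elim: s => [|i s IH].
    by move=> x Ax; apply: subset_closure; split.
  move=> x Ax U Ux.
  have [y [[Ay Vy] Uy]] := dV i x Ax _ (nbhs_interior Ux).
  have [|z [[Az sz] [Vz Uz]]] := IH y Ay (V i `&` U^°).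
    apply: filterI; apply: open_nbhs_nbhs; split => //.
    exact: open_interior.
  exists z; split; last exact: interior_subset.
  split => // j /=; rewrite in_cons => /predU1P[->//|js].
  exact: sz.
rewrite (_ : \bigcap_i V i = \bigcap_(i in [set` index_enum I]) V i)//.
by apply: eq_bigcapl; split => // i _ /=; rewrite mem_index_enum.
Qed.

Lemma open_bigcap_fin {T : topologicalType} {I : finType} (D : set I)
    (V : I -> set T) :
  (forall i, D i -> open (V i)) -> open (\bigcap_(i in D) V i).
Proof.
move=> oV; rewrite openE => x Vx.
have : \forall y \near x, forall i, D i -> V i y.
  apply: filter_forall => i; have [Di|nDi] := pselect (D i).
    apply: filterS (open_nbhs_nbhs (conj (oV i Di) (Vx i Di))) => y Viy _.
    exact: Viy.
  by apply: nearW => y /nDi.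
by apply: filterS => y Vy i; exact: Vy.
Qed.

(** Otherwise the complements of all the P i, and hence their intersection,
would belong to F. *)
Lemma ultra_bigcup {T : Type} {I : finType} (F : set_system T)
    (P : I -> set T) :
  UltraFilter F -> F (\bigcup_i P i) -> exists i, F (P i).
Proof.
move=> UF FP; apply: contrapT => /forallNP nF.
have FC : F [set x | forall i, (~` P i) x].
  by apply: filter_forall => i; have [/nF|] := in_ultra_setVsetC (P i) UF.
have [x [[i _ Pix] /(_ i)]] := filter_ex (filterI FP FC).
exact.
Qed.

End TopologicalFacts.

(** * Homeomorphisms and word maps *)

Section Homeomorphisms.
Set Implicit Arguments.
Unset Strict Implicit.
Context {R : realType} {X : metricType R}.
Implicit Types (f : X -> X) (U C : set X).

Lemma homeomorphism_image f : homeomorphism f ->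
  exists2 g, continuous g & forall U, f @` U = g @^-1` U.
Proof.
move=> [g [fK gK _ cg]]; exists g => // U.
by apply/seteqP; split => [_ [x Ux <-]|x Ux] /=; [rewrite fK|exists (g x)].
Qed.

Lemma homeomorphism_open f U : homeomorphism f -> open U -> open (f @` U).
Proof.
move=> /homeomorphism_image[g cg ->] oU.
by apply: open_comp => // x _; exact: cg.
Qed.

Lemma homeomorphism_closed f C : homeomorphism f -> closed C -> closed (f @` C).
Proof.
move=> /homeomorphism_image[g cg ->] cC.
by apply: preimage_closed => // x _; exact: cg.
Qed.

End Homeomorphisms.

Section Words.
Set Implicit Arguments.
Unset Strict Implicit.
Context {R : realType} {X : metricType R} {N : nat} (w : 'I_N -> X -> X).
Local Open Scope ring_scope.
Import Order.TTheory GRing.Theory Num.Theory.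
Implicit Types (A : set X) (u v : seq 'I_N).

Lemma word_map_cat u v x :
  word_map w (u ++ v) x = word_map w u (word_map w v x).
Proof. by elim: u => //= k u ->. Qed.

Lemma word_map_sub A u : A = \bigcup_k (w k @` A) -> word_map w u @` A `<=` A.
Proof.
move=> AE; elim: u => [|k u IH] _ [x Ax <-]//=.
rewrite AE; exists k => //; exists (word_map w u x) => //.
by apply: IH; exists x.
Qed.

Lemma word_map_cover A n : A = \bigcup_k (w k @` A) ->
  A `<=` \bigcup_(u : n.-tuple 'I_N) (word_map w u @` A).
Proof.
move=> AE; elim: n => [|n IH] x Ax.
  by exists [tuple] => //; exists x.
move: Ax; rewrite {1}AE => -[k _ [y /IH[u _ [z Az <-]] <-]].
by exists [tuple of k :: u] => //; exists z.
Qed.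

Hypothesis w_homeo : forall k, homeomorphism (w k).

Lemma word_map_homeo u : homeomorphism (word_map w u).
Proof.
elim: u => [|k u [g [gK Kg cf cg]]] /=.
  by exists id; split => // x; exact: cvg_id.
have [h [hK Kh ck ch]] := w_homeo k.
exists (g \o h); split.
- by move=> x /=; rewrite hK gK.
- by move=> x /=; rewrite Kg Kh.
- by move=> x; apply: continuous_comp; [exact: cf|exact: ck].
- by move=> x; apply: continuous_comp; [exact: ch|exact: cg].
Qed.

Lemma word_map_continuous u : continuous (word_map w u).
Proof. by have [g []] := word_map_homeo u. Qed.

End Words.

(** * Existence of the attractor *)

Section Attractor.
Set Implicit Arguments.
Unset Strict Implicit.
Context {R : realType} {X : completeMetricType R} {N : nat}.
Context (w : 'I_N -> X -> X).
Local Open Scope ring_scope.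
Import Order.TTheory GRing.Theory Num.Theory.
Implicit Types (A : set X) (u : seq 'I_N).
Hypothesis w_ch : forall k, contracting_homeo (w k).

Let w_homeo k : homeomorphism (w k). Proof. by have [] := w_ch k. Qed.

Lemma common_contraction_factor : exists c : R,
  [/\ 0 <= c, c < 1 & forall k x y, mdist (w k x) (w k y) <= c * mdist x y].
Proof.
have /choice[c cP] : forall k, exists c : R,
    [/\ 0 <= c, c < 1 & forall x y, mdist (w k x) (w k y) <= c * mdist x y].
  by move=> k; apply: contracting_lipschitz; have [] := w_ch k.
exists (\big[Num.max/0]_k c k); split.
- by rewrite bigmax_ge_id.
- by apply/bigmax_ltP; split => // k _; have [] := cP k.
- move=> k x y; have [_ _ /(_ x y)/le_trans->//] := cP k.
  by rewrite ler_wpM2r ?mdist_ge0// le_bigmax.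
Qed.

(** If every w k is c-Lipschitz, the word map of u is c^|u|-Lipschitz, and these
factors tend to 0 as the words get longer. *)
Lemma word_images_shrink A (e : R) : has_finite_diameter A -> 0 < e ->
  exists m, forall u, size u = m -> forall x y, A x -> A y ->
    mdist (word_map w u x) (word_map w u y) < e.
Proof.
move=> [D AD] e0; have [c [c0 c1 wc]] := common_contraction_factor.
have wcu u x y :
    mdist (word_map w u x) (word_map w u y) <= c ^+ size u * mdist x y.
  elim: u => [|k u IH] /=; first by rewrite expr0 mul1r.
  by rewrite (le_trans (wc _ _ _))// exprS -mulrA ler_wpM2l.
have cD : geometric D c @ \oo --> 0 by apply: cvg_geometric; rewrite ger0_norm.
have [m _ /(_ m (leqnn m)) /= mD] :
    \forall n \near \oo, D * c ^+ n < e.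
  by apply: cvgr_lt cD _ e0.
exists m => u um x y Ax Ay; rewrite (le_lt_trans (wcu _ _ _))// um.
by rewrite (le_lt_trans _ mD)// mulrC ler_wpM2r ?exprn_ge0// AD.
Qed.

(** If K bounds the displacements d(x, w_k(x)), then d(x, w_k(y)) is at most
K + c d(x, y), so the ball of centre x whose radius D satisfies D = K + c D is
mapped into itself by every w_k. *)
Lemma orbit_finite_diameter x :
  has_finite_diameter (range (fun u => word_map w u x)).
Proof.
have [c [c0 c1 wc]] := common_contraction_factor.
pose K : R := \big[Num.max/0]_k mdist x (w k x).
apply: (@finite_diameter_of_radius _ _ _ x (K / (1 - c))) => _ [u _ <-].
have K0 : 0 <= K by rewrite bigmax_ge_id.
elim: u => [|k u IH] /=; first by rewrite mdistxx divr_ge0// subr_ge0 ltW.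
have xk : mdist x (w k x) <= K by rewrite /K le_bigmax.
have -> : K / (1 - c) = K + c * (K / (1 - c)) by field; lra.
rewrite (le_trans (metric_triangle _ (w k x) _))// lerD//.
by rewrite (le_trans (wc _ _ _))// ler_wpM2l.
Qed.

(** Banach's theorem: the Picard iterates of w k are the images of one point
under the words k...k, so the orbit is bounded and its tails shrink. *)
Lemma exists_fixpoint k : exists x, w k x = x.
Proof.
pose x_ n := word_map w (nseq n k) point.
have x_C : cvg (x_ @ \oo).
  apply: cauchy_cvg; apply: cauchy_exP => e e0.
  have [m mP] := word_images_shrink (orbit_finite_diameter point) e0.
  exists (x_ m); exists m => // n /= mn.
  rewrite ballEmdist/= /x_ -(subnKC mn) nseqD word_map_cat.
  apply: mP; first by rewrite size_nseq.
    by exists [::].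
  by exists (nseq (n - m) k).
have wkC : continuous (w k) by have [g []] := w_homeo k.
exists (lim (x_ @ \oo)).
apply: (cvg_unique (@metric_hausdorff _ _) _ x_C) => /=.
rewrite -cvg_shiftS /=.
exact: (@cvg_comp _ _ _ x_ (w k) _ _ _ x_C (wkC _)).
Qed.

(** An ultrafilter on A contains, for every m, one of the finitely many pieces
of level m; these have arbitrarily small diameter, so the ultrafilter is Cauchy. *)
Lemma closed_selfsimilar_compact A :
  closed A -> has_finite_diameter A -> A = \bigcup_k (w k @` A) -> compact A.
Proof.
move=> clA dA AE; rewrite compact_ultra => F UF FA.
suff /cauchy_cvg Fp : cauchy F.
  by exists (lim F); split => //; apply: (@closed_cvg _ _ F _ id A) => //.
apply: cauchy_exP => e e0; have [m mP] := word_images_shrink dA e0.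
have [|u Fu] :=
    @ultra_bigcup _ _ F (fun u : m.-tuple _ => word_map w u @` A) UF.
  by apply: filterS FA; exact: word_map_cover.
have [_ [x Ax _]] := filter_ex Fu.
exists (word_map w u x); apply: filterS Fu => _ [y Ay <-].
by rewrite ballEmdist/=; apply: mP => //; rewrite size_tuple.
Qed.

Lemma attractorP : (0 < N)%N -> is_attractor w (attractor w).
Proof.
move=> N0; apply: xgetPex.
have [x0 wx0] := exists_fixpoint (Ordinal N0).
(* Starting from a fixed point puts x0 itself, the image of the empty word, in
   the image of E under one of the maps. *)
pose E := range (fun u => word_map w u x0).
have Ex0 : E x0 by exists [::].
have AE : closure E = \bigcup_k (w k @` closure E).
  apply/seteqP; split.
    apply: (@subset_trans _ (closure (\bigcup_k (w k @` closure E)))).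
      apply: closure_subset => _ [[|k u] _ <-] /=.
        by exists (Ordinal N0) => //; exists x0 => //; exact: subset_closure.
      exists k => //; exists (word_map w u x0) => //; apply: subset_closure.
      by exists u.
    apply: closed_bigcup; first exact: finite_finset.
    by move=> k _; apply: homeomorphism_closed => //; exact: closed_closure.
  move=> _ [k _ [x Ex <-]].
  have [g [_ _ wkC _]] := w_homeo k.
  have : closed (w k @^-1` closure E).
    by apply: preimage_closed => [y _|]; [exact: wkC|exact: closed_closure].
  apply; apply: closure_subset Ex => _ [u _ <-]; apply: subset_closure.
  by exists (k :: u).
exists (closure E); split => //.
  by exists x0; exact: subset_closure.
apply: closed_selfsimilar_compact => //; first exact: closed_closure.
exact/closure_finite_diameter/orbit_finite_diameter.
Qed.

End Attractor.

(** * The strong Markov property *)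

Section StrongMarkov.
Set Implicit Arguments.
Unset Strict Implicit.
Context {R : realType} {X : completeMetricType R} {N : nat}.
Context (w : 'I_N -> X -> X).
Local Open Scope ring_scope.
Import Order.TTheory GRing.Theory Num.Theory.
Hypotheses (w_ch : forall k, contracting_homeo (w k)) (N_gt0 : (0 < N)%N).

Local Notation A := (attractor w).

Let w_homeo k : homeomorphism (w k). Proof. by have [] := w_ch k. Qed.

Definition other_pieces n (i : n.-tuple 'I_N) : set X :=
  \bigcup_(j in [set j : n.-tuple 'I_N | j <> i]) (word_map w j @` A).

Lemma closed_word_image (u : seq 'I_N) : closed (word_map w u @` A).
Proof.
apply: homeomorphism_closed; first exact: word_map_homeo.
have [_ cA _] := attractorP w_ch N_gt0.
exact: (compact_closed (@metric_hausdorff _ _)).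
Qed.

Lemma open_not_other_pieces n (i : n.-tuple 'I_N) :
  open (word_map w i @^-1` ~` other_pieces i).
Proof.
apply: open_comp => [x _|]; first exact: word_map_continuous.
apply: closed_openC; apply: closed_bigcup; first exact: finite_finset.
by move=> j _; exact: closed_word_image.
Qed.

(** Let w_u(A) be a piece close to x, with |u| = m.  A point of w_i(w_u(A))
outside the other pieces of level n + m is outside w_j(A) for every other word j
of length n, because w_j(A) is the union of the pieces of level n + m whose
words extend j. *)
Lemma dense_not_other_pieces n (i : n.-tuple 'I_N) :
    (forall m, V_ (n + m) w) ->
  A `<=` closure (A `&` word_map w i @^-1` ~` other_pieces i).
Proof.
move=> wV x Ax U /nbhs_ballP[e /= e0 eU].
have [_ cA AE] := attractorP w_ch N_gt0.
have [m mP] := word_images_shrink w_ch (compact_finite_diameter cA) e0.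
have [u _ [y Ay ux]] := word_map_cover m AE Ax.
have [_ /(_ [tuple of i ++ u])] := wV m.
move=> /existsNP[_ /not_implyP[[a Aa <-] na]].
exists (word_map w u a); split; [split|].
- by apply: (word_map_sub AE); exists a.
- move=> [j ji [b /(word_map_cover m AE)[v _ [b' Ab' <-]] jb]].
  apply: na; exists [tuple of j ++ v].
    move=> /(congr1 val)/= /eqP; rewrite eqseq_cat ?size_tuple//.
    by move=> /andP[/eqP/val_inj].
  by exists b' => //=; rewrite word_map_cat jb word_map_cat.
- by apply: eU; rewrite ballEmdist/= -ux; apply: mP => //; rewrite size_tuple.
Qed.

Lemma strong_Markov_V n : (0 < n)%N -> strong_Markov w -> V_ n w.
Proof.
move=> n0 wS; have [U [oU dO disj]] := wS n n0; split => // i iV.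
have [[x Ax] _ _] := attractorP w_ch N_gt0.
have [y [Uy Ay]] : (U `&` A) !=set0.
  have xU : closure (U `&` A) x by rewrite dO.
  by have [y [Uy _]] := xU _ filterT; exists y.
have [|j ji [z Az jz]] := iV (word_map w i y); first by exists y.
move: Az; rewrite -dO => /(_ (word_map w j @^-1` (word_map w i @` U))).
case.
  apply: open_nbhs_nbhs; split; last by rewrite /= jz; exists y.
  apply: open_comp => [? _|]; first exact: word_map_continuous.
  by apply: homeomorphism_open => //; exact: word_map_homeo.
move=> t [[Ut _] it].
have : (word_map w i @` U `&` word_map w j @` U) (word_map w j t).
  by split => //; exists t.
by rewrite disj//; exact: nesym.
Qed.

Lemma V_strong_Markov : (forall n, (0 < n)%N -> V_ n w) -> strong_Markov w.
Proof.
move=> wV n n0; have [_ cA _] := attractorP w_ch N_gt0.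
have clA : closed A := compact_closed (@metric_hausdorff _ _) cA.
pose Q (p : n.-tuple 'I_N * n.-tuple 'I_N) : set X := word_map w p.1 @^-1`
  closer (word_map w p.1 @` A) (word_map w p.2 @` A).
exists (\bigcap_(p in [set p | p.1 <> p.2]) Q p); split.
- apply: open_bigcap_fin => p _; apply: open_comp => [x _|].
    exact: word_map_continuous.
  exact: open_closer.
- apply/seteqP; split.
    by rewrite {2}(closure_id A).1//; apply: closure_subset => x [].
  move=> x Ax.
  have dV (i : n.-tuple 'I_N) :
      A `<=` closure (A `&` word_map w i @^-1` ~` other_pieces i).
    by apply: dense_not_other_pieces => m; apply: wV; rewrite addn_gt0 n0.
  have := dense_open_bigcap (@open_not_other_pieces n) dV Ax.
  apply: closure_subset => y [Ay Vy]; split => // -[i j] ij.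
  apply: closer_setD; [exact: closed_word_image|by exists y|].
  by move=> jy; apply: (Vy i) => //; exists j => //; exact: nesym.
- move=> i j ij; rewrite -subset0 => z [[y Qy <-] [y' Qy' yy']].
  apply: (@closer_asym _ _
    (word_map w i @` A) (word_map w j @` A) (word_map w i y)).
    exact: (Qy (i, j)).
  by rewrite -yy'; apply: (Qy' (j, i)) => //; exact: nesym.
Qed.

End StrongMarkov.

Theorem theorem1 (R : realType) (X : completeMetricType R) (N : nat)
    (N_gt0 : (0 < N)%N) (w : 'I_N -> X -> X)
    (w_ch : forall k : 'I_N, contracting_homeo (w k)) :
  strong_Markov w <-> (\bigcap_(n in [set n : nat | (0 < n)%N]) V_ n) w.
Proof.
split=> [wSM n n0|wV]; first exact: strong_Markov_V.
exact: V_strong_Markov.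
Qed.
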